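(* Let $X=(x_{ij})$ be a real $m\times n$ matrix. Then \[ mn\sum_{i=1}^m\sum_{j=1}^n x_{ij}^2 + n\sum_{j=1}^n\left(\sum_{i=1}^m x_{ij}\right)^2 \ \ge\ m\sum_{i=1}^m\left(\sum_{j=1}^n x_{ij}\right)^2 + \left(\sum_{i=1}^m\sum_{j=1}^n x_{ij}\right)^2. \] *)

(* Defs.v *)
From mathcomp Require Import all_boot all_order all_algebra reals.

(* Main.v *)
Require Import Defs.
From mathcomp Require Import all_boot all_order all_algebra.
From mathcomp Require Import reals.
Import Order.TTheory GRing.Theory Num.Theory.
Local Open Scope ring_scope.

(** The inequality is the sum of two instances of the Cauchy-Schwarz bound
    [(\sum_i a i)^2 <= N * \sum_i (a i)^2] for [N] real numbers
    ([sqr_sum_le_card]).  Applied to each row of the matrix, summed over the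
    rows and multiplied by [m], it bounds the term in the squared row sums by
    the term in the squared entries.  Applied to the vector of the [n] column
    sums, whose total is the sum of all entries, it bounds the squared total
    by the term in the squared column sums. *)

(** Expanding the square as a double sum of products [a i * a j], each
    product satisfies [2 * (a i * a j) <= (a i)^2 + (a j)^2], and the double
    sum of the right-hand sides is twice [#|I|] times the sum of squares. *)
Lemma sqr_sum_le_card (R : realDomainType) (I : finType) (a : I -> R) :
  (\sum_i a i) ^+ 2 <= #|I|%:R * \sum_i a i ^+ 2.
Proof.
rewrite -(ler_pMn2r (n := 2)) //.
have -> : (#|I|%:R * \sum_i a i ^+ 2) *+ 2
          = \sum_i \sum_j (a i ^+ 2 + a j ^+ 2).
  under [RHS]eq_bigr do rewrite big_split sumr_const /=.
  by rewrite big_split sumr_const /= -sumrMnl mulr_natl mulr2n -sumrMnl.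
rewrite expr2 mulr_suml -sumrMnl; apply: ler_sum => i _.
rewrite mulr_sumr -sumrMnl; apply: ler_sum => j _.
by rewrite -subr_ge0 addrAC -sqrrB sqr_ge0.
Qed.

Theorem corollary3p2 (R : realType) (m n : nat) (x : 'M[R]_(m, n)) :
  m%:R * n%:R * (\sum_(i < m) \sum_(j < n) x i j ^+ 2)
    + n%:R * (\sum_(j < n) (\sum_(i < m) x i j) ^+ 2)
  >= m%:R * (\sum_(i < m) (\sum_(j < n) x i j) ^+ 2)
    + (\sum_(i < m) \sum_(j < n) x i j) ^+ 2.
Proof.
apply: lerD.
  rewrite -mulrA ler_wpM2l ?ler0n // mulr_sumr; apply: ler_sum => i _.
  by have := sqr_sum_le_card _ _ (x i); rewrite card_ord.
rewrite exchange_big /=.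
by have := sqr_sum_le_card _ _ (fun j => \sum_i x i j); rewrite card_ord.
Qed.
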